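(* Let $X$ be an infinite set and let $G$ be a subgroup of $\operatorname{Sym}(X)$ with no algebraicity. Then the topological space $(G,\mathfrak{Z}(G))$ is hyperconnected.
   Context: $\operatorname{Sym}(X)$ is the symmetric group on $X$ (all permutations of $X$, composed from left to right). Functions are written on the right of their arguments. For an infinite set $X$, a subgroup $G$ of $\operatorname{Sym}(X)$ has no algebraicity if for all finite $S\subseteq X$ and all $q\in X\setminus S$, the set $\{(q)g: g\in G \text{ such that } (x)g=x \text{ for all } x\in S\}$ is infinite. A topological space is hyperconnected if the intersection of any two nonempty open subsets is nonempty. A function $f:G\to G$ is a semigroup polynomial of degree $n$ if $(x)f=a_0xa_1\cdots xa_n$ for some $a_0,\ldots,a_n\in G$; constant functions are semigroup polynomials of degree $0$. The semigroup Zariski topology $\mathfrak{Z}(G)$ is the topology on $G$ generated (as a subbase) by the sets $\{x\in G:(x)f\neq (x)g\}$, where $f,g$ are semigroup polynomials. *)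

(* Defs.v *)
From HB Require Import structures.
From mathcomp Require Import all_boot.
From mathcomp Require Import all_classical topology_structure.

Set Implicit Arguments.
Unset Strict Implicit.
Unset Printing Implicit Defensive.

Local Open Scope classical_set_scope.
Local Open Scope group_scope.

Record Sym (X : Type) : Type := MkSym {
  sym_fun :> X -> X;
  sym_bij : bijective sym_fun
}.

Section SymGroup.
Variable X : Type.
Implicit Types g h : Sym X.

HB.instance Definition _ := gen_eqMixin (Sym X).
HB.instance Definition _ := gen_choiceMixin (Sym X).

Lemma sym_ext g h : (forall x, g x = h x) -> g = h.
Proof.
case: g h => [g gP] [h hP] /= gh.
have {}gh : g = h by apply/funext.
by rewrite gh in gP *; congr MkSym; exact: Prop_irrelevance.
Qed.

Definition sym_one : Sym X := @MkSym X id (inv_bij (fun=> erefl)).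

(* Permutations act on the right, so the image of x under g * h is h (g x). *)
Definition sym_mul g h : Sym X :=
  @MkSym X (h \o g) (bij_comp (sym_bij h) (sym_bij g)).

Lemma sym_inv_ex g : exists f : X -> X, cancel g f /\ cancel f g.
Proof. by case: (sym_bij g) => f gK fK; exists f. Qed.

Definition sym_inv g : Sym X :=
  let: exist f (conj gK fK) := cid (sym_inv_ex g) in MkSym (Bijective fK gK).

Lemma sym_invK g : cancel g (sym_inv g) /\ cancel (sym_inv g) g.
Proof. by rewrite /sym_inv; case: cid => f [gK fK]. Qed.

Lemma sym_mulA : associative sym_mul.
Proof. by move=> f g h; apply: sym_ext. Qed.

Lemma sym_mul1g : left_id sym_one sym_mul.
Proof. by move=> g; apply: sym_ext. Qed.

Lemma sym_mulg1 : right_id sym_one sym_mul.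
Proof. by move=> g; apply: sym_ext. Qed.

Lemma sym_mulVg : left_inverse sym_one sym_inv sym_mul.
Proof. by move=> g; apply: sym_ext => x; exact: (sym_invK g).2. Qed.

Lemma sym_mulgV : right_inverse sym_one sym_inv sym_mul.
Proof. by move=> g; apply: sym_ext => x; exact: (sym_invK g).1. Qed.

HB.instance Definition _ := isGroup.Build (Sym X)
  sym_mulA sym_mul1g sym_mulg1 sym_mulVg sym_mulgV.

End SymGroup.

(* groupClosed takes boolean predicates; this is no restriction, since the
   classical axioms turn any set T into one. *)
Definition subgroup_of (T : groupType) (G : groupClosed T) : Type :=
  {g : T | g \in G}.

Section Subgroup.
Variables (T : groupType) (G : groupClosed T).

HB.instance Definition _ := SubChoice.on (subgroup_of G).

Lemma groupClosed_group_closed : group_closed G.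
Proof.
by split=> [|u v uG vG]; [exact: gpred1 | exact: gpredM uG (gpredVr _ vG)].
Qed.

HB.instance Definition _ := SubChoice_isSubGroup.Build
  T (mem G) (subgroup_of G) groupClosed_group_closed.

End Subgroup.

Definition no_algebraicity (X : Type) (G : groupClosed (Sym X)) : Prop :=
  forall (S : set X) (q : X), finite_set S -> ~ S q ->
    infinite_set
      [set y | exists g : Sym X,
         [/\ g \in G, (forall x, S x -> g x = x) & y = g q]].

Definition hyperconnected (T : topologicalType) : Prop :=
  forall U V : set T, open U -> open V ->
    U !=set0 -> V !=set0 -> U `&` V !=set0.

Definition semigroup_polynomial_of_degree
    (G : groupType) (n : nat) (f : G -> G) : Prop :=
  exists a : 'I_n.+1 -> G,
    forall x, f x = a ord0 * \prod_(i < n) (x * a (lift ord0 i)).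

Definition semigroup_polynomial (G : groupType) (f : G -> G) : Prop :=
  exists n, semigroup_polynomial_of_degree n f.

Definition zariski_subbase (G : groupType) : set (set G) :=
  [set U | exists f g : G -> G, [/\ semigroup_polynomial f,
     semigroup_polynomial g & U = [set x | f x <> g x]]].

(* An alias, so that G itself does not inherit the topology. *)
Definition zariski (G : groupType) : Type := G.

HB.instance Definition _ (G : groupType) := Choice.on (zariski G).
HB.instance Definition _ (G : groupType) :=
  isSubBaseTopological.Build (zariski G) (@zariski_subbase G) id.

(* Main.v *)
Require Import Defs.
From HB Require Import structures.
From mathcomp Require Import all_boot finmap.
From mathcomp Require Import all_classical topology_structure.

(** Two polynomials that differ at some element of [G] can be told apart by
    following one point of [X].  Cancelling the common left factors turns the
    pair into words [c x a_1 x a_2 ...] and [d x b_1 x b_2 ...] which either have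
    [c <> d], or of which exactly one still involves [x].  Starting both words at
    a suitable point [p] gives two trajectories that are already forked, whatever
    the value of [x] (lemma [separating_fork]).

    It remains to find one [x] in [G] that keeps finitely many forks apart
    simultaneously (lemma [keep_apart]). Such an [x] is built by successive
    corrections: its value is prescribed at one more point at a time, always
    at the current position [w] of a trajectory that is waiting for [x]. No
    algebraicity leaves infinitely many possible images of [w] once the
    earlier values are prescribed, so the image can be chosen such that every
    trajectory passing through [w] lands on a point which is neither already
    in the domain nor the present position of any trajectory. Hence forked
    pairs stay forked and no trajectory ever returns to a point whose image
    has been prescribed, which could force two trajectories to merge; after
    finitely many steps all the trajectories have ended, and they have ended
    at different points.

    A nonempty open set contains a nonempty finite intersection of subbasic sets,
    so this says that any two nonempty open sets meet. *)

Set Implicit Arguments.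
Unset Strict Implicit.
Unset Printing Implicit Defensive.

Local Open Scope classical_set_scope.
Local Open Scope group_scope.

(** * Words in one variable *)

Section Words.
Variable H : groupType.
Implicit Types (c d x : H) (s t : seq H).

Definition word c s x : H := foldl (fun z a => z * x * a) c s.

Lemma word_mull h c s x : word (h * c) s x = h * word c s x.
Proof. by elim: s c => //= a s IH c; rewrite -IH !mulgA. Qed.

Lemma semigroup_polynomial_word (f : H -> H) :
  semigroup_polynomial f -> exists c s, f = word c s.
Proof.
move=> [n [a fE]]; exists (a ord0), [seq a (lift ord0 i) | i <- enum 'I_n].
apply/funext => x; rewrite fE -[index_enum _]enumT.
elim: (enum _) (a ord0) => [|i r IH] c; first by rewrite big_nil mulg1.
by rewrite big_cons /= -IH !mulgA.
Qed.

End Words.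

(** * Trajectories of points *)

Section Trajectories.
Variable X : Type.
Implicit Types (x : Sym X) (w y : X).

(** A point, together with the coefficients still to be applied to it, each of
    them preceded by an application of the indeterminate permutation. *)
Definition trajectory : Type := (X * seq (Sym X))%type.

Implicit Types u v : trajectory.

Definition endpoint x u : X := foldl (fun z a : _ => (a : Sym X) (x z)) u.1 u.2.

(** If both trajectories are to continue, or both have ended, their positions
    must differ.  If only one has ended, the positions may coincide, since the
    other one is about to be moved away. *)
Definition forked u v : Prop := u.1 <> v.1 \/ nilp u.2 != nilp v.2.

Definition advance w y u : trajectory :=
  if u.2 is a :: s then if `[< u.1 = w >] then (a y, s) else u else u.

Variant advance_spec w y u : trajectory -> Prop :=
| AdvanceMove a s of u = (w, a :: s) : advance_spec w y u (a y, s)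
| AdvanceStay of (u.2 <> [::] -> u.1 <> w) : advance_spec w y u u.

Lemma advanceP w y u : advance_spec w y u (advance w y u).
Proof.
case: u => z [|a s]; rewrite /advance /=; first by constructor.
by case: asboolP => [->|zw]; constructor.
Qed.

Lemma endpoint_advance x w y u :
  x w = y -> endpoint x (advance w y u) = endpoint x u.
Proof. by move=> xw; case: advanceP => // a s ->; rewrite /endpoint /= xw. Qed.

Lemma size_advance w y u : size (advance w y u).2 <= size u.2.
Proof. by case: advanceP => // a s ->. Qed.

Lemma size_advance_lt w y u :
  u.2 <> [::] -> u.1 = w -> size (advance w y u).2 < size u.2.
Proof. by move=> u2 uw; case: advanceP => [a s ->|/(_ u2)]. Qed.

Definition bad_images (F : set X) u : set X :=
  if u.2 is a :: _ then a @^-1` F else set0.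

Lemma finite_bad_images (F : set X) u : finite_set F -> finite_set (bad_images F u).
Proof.
rewrite /bad_images; case: u.2 => [|a s] finF; first exact: finite_set0.
by apply: finite_preimage => // y z _ _; exact: (bij_inj (sym_bij a)).
Qed.

(** Two forked trajectories cannot both be waiting at [w], so at most one of them
    moves, and it moves away from the other one. *)
Lemma forked_advance (F : set X) w y u v :
  F u.1 -> F v.1 -> ~ bad_images F u y -> ~ bad_images F v y ->
  forked u v -> forked (advance w y u) (advance w y v).
Proof.
move=> Fu Fv; case: (advanceP w y u) => [a s ->|_];
  case: (advanceP w y v) => [b t ->|_] //= nFu nFv.
- by case.
- by left=> /= e; apply: nFu; rewrite /bad_images /= e.
- by left=> /= e; apply: nFv; rewrite /bad_images /= -e.
Qed.

End Trajectories.

(** * Keeping finitely many forks apart *)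

Section KeepApart.
Variables (X : Type) (G : groupClosed (Sym X)).
Hypothesis noalgG : no_algebraicity G.
Implicit Types (x : Sym X) (D B : set X).

(** Composing [x0] with the pointwise stabiliser of [D] leaves its values on [D]
    unchanged, and gives the point [w] infinitely many images. *)
Lemma extend_avoiding D B (x0 : Sym X) (w : X) :
  finite_set D -> finite_set B -> x0 \in G -> ~ D w ->
  exists x : Sym X, [/\ x \in G, forall z, D z -> x z = x0 z & ~ B (x w)].
Proof.
move=> finD finB x0G Dw; apply: contrapT => noext.
apply: (noalgG finD Dw); apply: (@sub_finite_set _ _ (x0 @^-1` B)).
  move=> _ [g [gG gD ->]]; apply: contrapT => nB; apply: noext.
  exists (g * x0); split; [exact: gpredM| |exact: nB].
  by move=> z /gD gz; rewrite -[in RHS]gz.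
by apply: finite_preimage => // y z _ _; exact: (bij_inj (sym_bij x0)).
Qed.

(** The set [D] is the domain on which the values of the permutation, those of
    [x0], are already prescribed.  The invariant that no trajectory waits at a
    point of [D] keeps every next step free; each step consumes at least one
    coefficient, whence the induction on their number. *)
Lemma keep_apart (I : finType) (th : I * bool -> trajectory X) D (x0 : Sym X) :
  finite_set D -> x0 \in G ->
  (forall j, (th j).2 <> [::] -> ~ D (th j).1) ->
  (forall i, forked (th (i, false)) (th (i, true))) ->
  exists x : Sym X, [/\ x \in G, forall z, D z -> x z = x0 z &
    forall i, endpoint x (th (i, false)) <> endpoint x (th (i, true))].
Proof.
have [N] := ubnP (\sum_j size (th j).2).
elim: N => // N IH in th D x0 * => leN finD x0G freshD forks.
have [[j thj]|ended] := pselect (exists j, (th j).2 <> [::]); last first.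
  have th0 j : (th j).2 = [::] by apply: contrapT => thj; apply: ended; exists j.
  exists x0; split=> // i; rewrite /endpoint !th0 /=.
  by case: (forks i) => //; rewrite !th0.
pose w := (th j).1.
(* The new positions must avoid [F], and so the image of [w] must avoid [B]. *)
pose F := D `|` [set w] `|` range (fun k => (th k).1).
have finF : finite_set F.
  rewrite !finite_setU; split; first by split=> //; exact: finite_set1.
  by apply: finite_image; exact: finite_finset.
have Fhead k : F (th k).1 by right; exists k.
pose B := \bigcup_k bad_images F (th k).
have finB : finite_set B.
  apply: bigcup_finite => [|k _]; first exact: finite_finset.
  exact: finite_bad_images.
have [x1 [x1G x1D nB]] := extend_avoiding finD finB x0G (freshD j thj).
rewrite -/w in nB.
have good k : ~ bad_images F (th k) (x1 w) by move=> bad; apply: nB; exists k.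
case: (IH (fun k => advance w (x1 w) (th k)) (D `|` [set w]) x1) => //.
- rewrite ltnS in leN; apply: leq_trans leN; rewrite (bigD1 j) //=.
  rewrite [ltnRHS](bigD1 j) //= -addSn.
  apply: leq_add; first exact: size_advance_lt.
  by apply: leq_sum => k _; exact: size_advance.
- by rewrite finite_setU; split=> //; exact: finite_set1.
- move=> k; case: advanceP => [a s thk|thk] /= s0.
    by move=> Da; apply: (good k); rewrite thk /bad_images /=; left.
  by move=> [|]; [exact: freshD|exact: thk].
- by move=> i; apply: (@forked_advance _ F).
move=> x [xG xD apart]; exists x; split=> // [z Dz|i].
  by rewrite xD ?x1D //; left.
have xw : x w = x1 w by apply: xD; right.
by have := apart i; rewrite !(endpoint_advance _ xw).
Qed.

End KeepApart.

(** * Separating polynomials and the Zariski topology *)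

Lemma zariski_open_finI (H : groupType) (U : set (zariski H)) (x : H) :
  open U -> U x -> exists D : {fset set H},
    [/\ forall A, A \in D -> zariski_subbase A, (\bigcap_(A in [set` D]) A) x &
      \bigcap_(A in [set` D]) A `<=` U].
Proof.
move=> [B subB <-] [A BA Ax]; have [D subD DA] := subB _ BA.
exists D; split=> [C CD||z Dz]; first by apply/set_mem/subD.
  by move: Ax; rewrite -DA.
by exists A => //; rewrite -DA.
Qed.

Section Zariski.
Variables (X : Type) (G : groupClosed (Sym X)).
Implicit Types (c d x : subgroup_of G) (s t : seq (subgroup_of G)).

Lemma val_word c s x (p : X) :
  val (word c s x) p = endpoint (val x) (val c p, map val s).
Proof.
by rewrite /endpoint /=; elim: s c => //= a s IH c; rewrite IH.
Qed.

Lemma exists_val_neq c d : c <> d -> exists p, val c p <> val d p.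
Proof.
move=> cd; apply: contrapT => same; apply/cd/val_inj/sym_ext => p.
by apply: contrapT => cdp; apply: same; exists p.
Qed.

Definition contains_fork_separators (A : set (subgroup_of G)) : Prop :=
  exists uv : trajectory X * trajectory X, forked uv.1 uv.2 /\
    forall x, endpoint (val x) uv.1 <> endpoint (val x) uv.2 -> A x.

(** Common left factors are cancelled until the words fork: at unequal leading
    constants, from a point which these constants send to different points, and
    otherwise, when exactly one of the words is exhausted, from any point. *)
Lemma separating_fork (p0 : X) c s d t x0 :
  word c s x0 <> word d t x0 ->
  contains_fork_separators [set x | word c s x <> word d t x].
Proof.
have start p c' s' d' t' :
    forked (val c' p, map val s') (val d' p, map val t') ->
    contains_fork_separators [set x | word c' s' x <> word d' t' x].
  exists ((val c' p, map val s'), (val d' p, map val t')); split=> // x /=.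
  by move=> neq e; apply: neq; rewrite -!val_word e.
have start_neq c' s' d' t' : c' <> d' ->
    contains_fork_separators [set x | word c' s' x <> word d' t' x].
  by move=> /exists_val_neq[p cdp]; apply: (start p); left.
elim: s t c d => [|a s IH] [|b t] c d.
- by move=> cd; exact: start_neq.
- by move=> _; apply: (start p0); right.
- by move=> _; apply: (start p0); right.
- have [<-|cd _] := pselect (c = d); last exact: start_neq.
  rewrite /= !word_mull => neq.
  have /IH[uv [fuv sep]] : word a s x0 <> word b t x0.
    by move=> e; apply: neq; rewrite e.
  by exists uv; split=> // x /sep sepx; rewrite /= !word_mull => /mulgI.
Qed.

Lemma zariski_subbase_fork (p0 : X) (A : set (subgroup_of G)) :
  zariski_subbase A -> A !=set0 -> contains_fork_separators A.
Proof.
move=> [f [g [/semigroup_polynomial_word[c [s ->]]]]].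
move=> /semigroup_polynomial_word[d [t ->]] ->.
by move=> [x0 /(separating_fork p0)].
Qed.

Hypothesis noalgG : no_algebraicity G.

Lemma zariski_subbase_bigcap (p0 : X) (D : {fset set (subgroup_of G)}) :
  (forall A, A \in D -> zariski_subbase A /\ A !=set0) ->
  \bigcap_(A in [set` D]) A !=set0.
Proof.
move=> subD.
have [/= uv uvP] := choice (fun i : D =>
  zariski_subbase_fork p0 (subD _ (valP i)).1 (subD _ (valP i)).2).
pose th (j : D * bool) := if j.2 then (uv j.1).2 else (uv j.1).1.
have [||||x [xG _ apart]] := @keep_apart X G noalgG D th set0 1.
- exact: finite_set0.
- exact: gpred1.
- by move=> j _ [].
- by move=> i; exact: (uvP i).1.
exists (Sub x xG) => A /= AD.
by apply: (uvP [` AD]%fset).2; rewrite SubK; exact: apart.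
Qed.

End Zariski.

Theorem theorem1p12 (X : Type) (G : groupClosed (Sym X)) :
  infinite_set [set: X] ->
  no_algebraicity G ->
  hyperconnected (zariski (subgroup_of G)).
Proof.
move=> infX noalgG U V openU openV [x Ux] [y Vy].
have [EA [subEA EAx EAU]] := zariski_open_finI openU Ux.
have [EB [subEB EBy EBV]] := zariski_open_finI openV Vy.
have [p0 _] : [set: X] !=set0.
  apply: contrapT => X0; apply: infX.
  suff -> : [set: X] = set0 by exact: finite_set0.
  by apply/eqP/negPn/negP => /set0P.
have [C EC|z Cz] := @zariski_subbase_bigcap X G noalgG p0 (EA `|` EB)%fset.
  case/fsetUP: EC => EC; split.
  - exact: subEA.
  - by exists x; exact: EAx.
  - exact: subEB.
  - by exists y; exact: EBy.
exists z; split; [apply: EAU|apply: EBV] => C /= EC; apply: Cz.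
  by rewrite /= inE EC.
by rewrite /= inE EC orbT.
Qed.
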